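(* Let $B$ be a participant in a clustering task that repeats the protocol described in the context (steps 1-5) $R$ times, where $B$ holds the vector $x_j$, and let $\{\mu^{(r)}\}$ be the cluster centroids at round $r$ of the clustering. Assume that the eavesdropper $E$ assigns prior probability $1/2$ to the event that $B$ participated in the protocol, and wishes to determine whether $B$ contributed $x_j$ (which may not be known to $E$) to the clustering. The maximum probability, over all quantum strategies, of $E$ successfully deciding this is $$\frac12+O\left(\frac{Rd}{\min_{p,r}P(f(x_j,\{\mu^{(r)}\})=p)\,N\epsilon}\right)$$ if $\min_{p,r}P(f(x_j,\{\mu^{(r)}\})=p)>\epsilon$.
   Context: There are $N$ potential participants, each holding a private $d$-dimensional vector $x_j$ ($j=1,\dots,N$), and $k$ clusters. For centroids $\{\mu\}=\{\mu_1,\dots,\mu_k\}$, $f(x_j,\{\mu\})\in\{1,\dots,k\}$ is the index of the centroid closest to $x_j$ (ties broken at random), and $P(f(x_j,\{\mu\})=p)$ denotes the fraction of the $N$ potential participants assigned to cluster $p$ (participants may decline, so these may sum to less than $1$). $\epsilon$ is the target error of the protocol. $Z$ is the Pauli $Z$ operator. Protocol (one round): 1. The experimenter broadcasts $k$ cluster centroids over a public classical channel. 2. For each centroid $\mu_p$, the experimenter sends each participant one qubit of the $N$-qubit state $(|0\rangle^{N}+|1\rangle^{N})/\sqrt2$. 3. Each participant that decides to contribute applies $e^{-iZ/2N}$ to the qubit corresponding to the cluster closest to their vector (ties broken at random), and the qubit is returned to the experimenter. 4. The experimenter repeats steps 2 and 3 of this protocol (sending the participants the qubits of the states $(|0\rangle^{N}+|1\rangle^{N})/\sqrt2$,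 and having each contributing participant apply $e^{-iZ/2N}$ to the qubit of their closest cluster and return it) $O(1/\epsilon)$ times in a phase estimation protocol to learn $P(f(x_j,\{\mu\})=p)$ within error $\epsilon$. 5. The experimenter performs the same procedure except that phase estimation is now performed for each of the $d$ components of the vectors (so the phase imprinted by a participant in cluster $p$ for component $q$ is $[x_j]_q/N$, in place of $1/N$), a total of $O(d/(\epsilon P(f(x_j,\{\mu\})=p)))$ rotations for each cluster $p$. After each round the experimenter updates the centroids from these values. Adversary model: $E$ is computationally unbounded, has no prior knowledge of the users' private data, and may control any and all other parties, including the experimenter; in particular $E$ may supply $B$ with arbitrary (entangled or mixed) quantum states in place of the prescribed ones. $B$ sends no classical communication to the experimenter.
   Formalization: The entries of x_j are assumed bounded in absolute value by some X and the O-constant depends on X; without this the claim fails, e.g. k=d=R=1, ε=1/2, x_j=πN lets E decide with certainty in one use of step 5. *)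

(* Defs.v *)
From HB Require Import structures.
From mathcomp Require Import all_boot all_order all_algebra.
From mathcomp Require Import all_classical all_reals all_analysis.
From mathcomp Require Import complex sesquilinear spectral.
From mathcomp Require mxtens.

Set Implicit Arguments.
Unset Strict Implicit.
Unset Printing Implicit Defensive.
Import Order.TTheory GRing.Theory Num.Theory.
Local Open Scope ring_scope.
Local Open Scope sesquilinear_scope.
Local Open Scope complex_scope.

Section QuantumMechanics.
Variable R : realType.
Local Notation C := R[i].

(* The order of [R[i]] makes [0 <= z] say that z is real and nonnegative, so
   this includes hermitianity. *)
Definition psdmx n (A : 'M[C]_n) : Prop :=
  forall v : 'rV[C]_n, 0 <= (v *m A *m v^t*) 0 0.

Definition density n (rho : 'M[C]_n) : Prop := psdmx rho /\ \tr rho = 1.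

Definition effect n (F : 'M[C]_n) : Prop := psdmx F /\ psdmx (1%:M - F).

Definition channel n (K : seq 'M[C]_n) : Prop :=
  \sum_(A <- K) A^t* *m A = 1%:M.

Definition apply_channel n (K : seq 'M[C]_n) (rho : 'M[C]_n) : 'M[C]_n :=
  \sum_(A <- K) A *m rho *m A^t*.

Definition pauliZ : 'M[C]_2 := diag_mx (\row_b ((-1) ^+ (b : nat))).

(* [e^{-itZ}], by Euler's formula since Z^2 = 1. *)
Definition expNiZ (t : R) : 'M[C]_2 :=
  (cos t)%:C%:M - (0 +i* sin t) *: pauliZ.

(* Basis states of a register of k qubits, one per cluster. *)
Definition qdim (k : nat) : nat := #|{ffun 'I_k -> 'I_2}|.

Definition qbits k (a : 'I_(qdim k)) : {ffun 'I_k -> 'I_2} := enum_val a.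

Definition on_qubit k (p : 'I_k) (U : 'M[C]_2) : 'M[C]_(qdim k) :=
  \matrix_(a, b)
    if [forall p' : 'I_k, (p' != p) ==> (qbits a p' == qbits b p')]
    then U (qbits a p) (qbits b p) else 0.

End QuantumMechanics.

Section Clustering.
Variable R : realType.

Definition dist2 d (x y : 'rV[R]_d) : R :=
  Num.sqrt (\sum_(q < d) (x 0 q - y 0 q) ^+ 2).

(* The possible values of [f(x, {mu})].  In case of a tie there are several, and
   the one taken by f is any outcome of the random choice between them. *)
Definition closest d k (x : 'rV[R]_d) (mu : 'I_k -> 'rV[R]_d) (p : 'I_k) : Prop :=
  forall p' : 'I_k, dist2 x (mu p) <= dist2 x (mu p').

(* [P(f(x_j, {mu}) = p)], where f i is the cluster of participant i and S is
   the set of participants that do not decline. *)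
Definition fraction N k (S : {set 'I_N}) (f : 'I_N -> 'I_k) (p : 'I_k) : R :=
  #|[set i in S | f i == p]|%:R / N%:R.

(* The index 1 of the minima is neutral: fractions are at most 1. *)
Definition min_fraction rounds N k (S : 'I_rounds -> {set 'I_N})
    (f : 'I_rounds -> 'I_N -> 'I_k) : R :=
  \big[Num.min/1]_(r < rounds) \big[Num.min/1]_(p < k) fraction (S r) (f r) p.

End Clustering.

Section Protocol.
Variable R : realType.
Local Notation C := R[i].

(* A turn is one exchange of qubits, one per cluster, between the experimenter
   and a participant.  The first component is [None] in the turns that estimate
   the fractions and [Some q] in those that estimate component q.  The second
   one is the set of clusters whose phase estimation uses this turn; the qubits
   of the other clusters are left alone, that is, effectively not sent. *)
Definition turn (d k : nat) : Type := (option 'I_d * {set 'I_k})%type.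

(* One round: n4 turns for the fractions, then n5 p q turns for component q in
   cluster p. *)
Definition round_turns d k (n4 : nat) (n5 : 'I_k -> 'I_d -> nat) :
    seq (turn d k) :=
  nseq n4 (None, [set: 'I_k]) ++
  flatten [seq [seq (Some q, [set p | (t < n5 p q)%N])
               | t <- iota 0 (\max_(p < k) n5 p q)] | q <- enum 'I_d].

(* What a participant with vector x, assigned to cluster p, applies to the
   qubits received; b tells whether the participant contributes.  The phase
   imprinted by [e^{-i phase Z/2}] is relative, hence the division by 2. *)
Definition response (b : bool) (N d k : nat) (x : 'rV[R]_d) (p : 'I_k)
    (t : turn d k) : 'M[C]_(qdim k) :=
  let phase := (if t.1 is Some q then x 0 q else 1) / N%:R in
  if b && (p \in t.2) then on_qubit p (expNiZ (phase / 2)) else 1%:M.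

Definition responses (b : bool) (rounds N d k : nat) (x : 'rV[R]_d)
    (f : 'I_rounds -> 'I_k) (n4 : 'I_rounds -> nat)
    (n5 : 'I_rounds -> 'I_k -> 'I_d -> nat) : seq 'M[C]_(qdim k) :=
  flatten [seq [seq response b N x (f r) t | t <- round_turns (n4 r) (n5 r)]
          | r <- enum 'I_rounds].

(* E holds a memory of arbitrary finite dimension, prepares an arbitrary joint
   state of the k qubits and the memory, applies an arbitrary joint channel
   each time the qubits come back, and ends with a two-outcome measurement.
   [guess] is the effect of the outcome "B contributed". *)
Record strategy (k : nat) := Strategy {
  memory : nat;
  init : 'M[C]_(qdim k * memory);
  step : nat -> seq 'M[C]_(qdim k * memory);
  guess : 'M[C]_(qdim k * memory) }.

Definition valid_strategy k (s : strategy k) : Prop :=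
  [/\ density (init s), forall t, channel (step s t) & effect (guess s)].

Fixpoint run k (s : strategy k) (V : seq 'M[C]_(qdim k)) (t : nat)
    (rho : 'M[C]_(qdim k * memory s)) : 'M[C]_(qdim k * memory s) :=
  if V is U :: V' then
    let W := mxtens.tensmx U (1%:M : 'M[C]_(memory s)) in
    run V' t.+1 (apply_channel (step s t) (W *m rho *m W^t*))
  else rho.

(* Success probability of s for the prior 1/2; V b lists what B applies,
   according to whether B contributes. *)
Definition success k (s : strategy k) (V : bool -> seq 'M[C]_(qdim k)) : R :=
  2^-1 * complex.Re (\tr (guess s *m run (V true) 0 (init s))) +
  2^-1 * complex.Re (\tr ((1%:M - guess s) *m run (V false) 0 (init s))).

Definition max_success k (V : bool -> seq 'M[C]_(qdim k)) : R :=
  sup (fun w : R => exists2 s : strategy k, valid_strategy s & w = success s V).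

End Protocol.

(* Main.v *)
(* For a fixed strategy and a fixed turn, the rest of the protocol and the final
   measurement form a single effect F acting on the state right after B's gate.
   So, by a hybrid argument, B's contribution changes the probability of the
   guess by at most the sum over the turns of
   |tr (F W rho W') - tr (F rho)|, where W' is the adjoint of
   W = cos t - i sin t Z for a hermitian involution Z; this is O(|t|), and t is
   O(1/N).  A round has O(1/eps) turns for the fractions and, as B acts only on
   the qubit of its own cluster p, O(d/(eps P)) turns that matter for the
   components. *)
Require Import Defs.
From mathcomp Require Import all_boot all_order all_algebra.
From mathcomp Require Import all_classical all_reals all_analysis.
From mathcomp Require Import complex sesquilinear spectral.
From mathcomp Require Import ring lra.
From mathcomp Require mxtens.
Import Order.TTheory GRing.Theory Num.Theory numFieldNormedType.Exports.
Local Open Scope ring_scope.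
Local Open Scope sesquilinear_scope.
Local Open Scope complex_scope.
Set Implicit Arguments.
Unset Strict Implicit.
Unset Printing Implicit Defensive.

(** * Algebra of the adjoint *)

Section Adjoint.
Variable C : numClosedFieldType.

Lemma adjmxM m n p (A : 'M[C]_(m, n)) (B : 'M[C]_(n, p)) :
  (A *m B)^t* = B^t* *m A^t*.
Proof. by rewrite trmx_mul map_mxM. Qed.

Lemma adjmxD m n (A B : 'M[C]_(m, n)) : (A + B)^t* = A^t* + B^t*.
Proof. by rewrite linearD map_mxD. Qed.

Lemma adjmxB m n (A B : 'M[C]_(m, n)) : (A - B)^t* = A^t* - B^t*.
Proof. by rewrite linearB map_mxB. Qed.

Lemma adjmxZ m n (a : C) (A : 'M[C]_(m, n)) : (a *: A)^t* = a^* *: A^t*.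
Proof. by rewrite linearZ map_mxZ. Qed.

Lemma adjmx1 n : (1%:M : 'M[C]_n)^t* = 1%:M.
Proof. by rewrite trmx1 map_mx1. Qed.

End Adjoint.

(** * Positive matrices, measurement probabilities and channels *)

Section PositiveSemidefinite.
Variable R : realType.
Local Notation C := R[i].

Lemma psdmx_conj m n (B : 'M[C]_(m, n)) (A : 'M[C]_n) :
  psdmx A -> psdmx (B *m A *m B^t*).
Proof. by move=> psdA v; have := psdA (v *m B); rewrite adjmxM !mulmxA. Qed.

Lemma psdmx_conjV m n (B : 'M[C]_(n, m)) (A : 'M[C]_n) :
  psdmx A -> psdmx (B^t* *m A *m B).
Proof. by move=> /(psdmx_conj (B^t*)); rewrite trmxCK. Qed.

Lemma psdmx0 n : psdmx (0 : 'M[C]_n).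
Proof. by move=> v; rewrite mulmx0 mul0mx mxE. Qed.

Lemma psdmxD n (A B : 'M[C]_n) : psdmx A -> psdmx B -> psdmx (A + B).
Proof. by move=> pA pB v; rewrite mulmxDr mulmxDl mxE addr_ge0. Qed.

Lemma psdmx_sum n (T : Type) (s : seq T) (F : T -> 'M[C]_n) :
  (forall i, psdmx (F i)) -> psdmx (\sum_(i <- s) F i).
Proof.
by move=> pF; elim/big_ind: _ => //; [exact: psdmx0 | exact: psdmxD].
Qed.

Lemma psdmx1 n : psdmx (1%:M : 'M[C]_n).
Proof.
move=> v; rewrite mulmx1 mxE sumr_ge0// => i _.
by rewrite !mxE mul_conjC_ge0.
Qed.

Lemma psdmx_diag_ge0 n (A : 'M[C]_n) i : psdmx A -> 0 <= A i i.
Proof.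
move=> /(_ (delta_mx 0 i)); rewrite -rowE mxE (bigD1 i)//= big1 => [|j ji].
  by rewrite !mxE !eqxx conjC1 mulr1 addr0.
by rewrite !mxE (negPf ji) andbF conjC0 mulr0.
Qed.

Lemma psdmx_tr_ge0 n (A : 'M[C]_n) : psdmx A -> 0 <= \tr A.
Proof. by move=> pA; apply: sumr_ge0 => i _; exact: psdmx_diag_ge0. Qed.

(* Polarization: the skew-hermitian part [A - A^t*] has a vanishing quadratic
   form, which is evaluated at [e_i + a e_j] for [a = 1] and [a = 'i]. *)
Lemma psdmx_adj n (A : 'M[C]_n) : psdmx A -> A^t* = A.
Proof.
move=> pA; apply/eqP; rewrite eq_sym -subr_eq0; apply/eqP.
set H := A - A^t*.
have H0 (v : 'rV[C]_n) : (v *m H *m v^t*) 0 0 = 0.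
  have -> : v *m H *m v^t* = v *m A *m v^t* - (v *m A *m v^t*)^t*.
    by rewrite !adjmxM trmxCK mulmxBr mulmxBl !mulmxA.
  have /CrealP vAv : (v *m A *m v^t*) 0 0 \is Num.real by rewrite ger0_real.
  rewrite [LHS]mxE [(- _ ^t*) 0 0]mxE [(_ ^t*) 0 0]mxE [X in _ - X^*]mxE.
  by rewrite vAv subrr.
have Hij i j (a : C) : H i i + a * a^* * H j j + a^* * H i j + a * H j i = 0.
  rewrite -(H0 (delta_mx 0 i + a *: delta_mx 0 j)) mulmxDl -scalemxAl -!rowE.
  rewrite adjmxD adjmxZ mulmxDr !mulmxDl -!scalemxAl -!scalemxAr.
  have rowd k l : (row k H *m (delta_mx 0 l : 'rV[C]_n)^t*) = (H k l)%:M.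
    apply/matrixP => u v; rewrite !ord1 mxE (bigD1 l)//= big1 => [|t tl].
      by rewrite !mxE !eqxx conjC1 mulr1 addr0.
    by rewrite !mxE (negPf tl) andbF conjC0 mulr0.
  rewrite !rowd !mxE /=; ring.
have Hii i : H i i = 0 by have := Hij i i 0; rewrite conjC0 !mul0r !addr0.
apply/matrixP => i j; rewrite [RHS]mxE.
have := Hij i j 1; have := Hij i j 'i.
rewrite !Hii conjC1 conjCi !mulr0 !mul1r !add0r mulNr => e1 e2.
have : 'i * H j i = 'i * H i j by apply/eqP; rewrite -subr_eq0 addrC; apply/eqP.
move=> /(mulfI (neq0Ci _)) e3; move: e2; rewrite e3 -mulr2n => /eqP.
by rewrite mulrn_eq0 => /eqP.
Qed.

(** By the spectral theorem [A] is unitarily similar to a diagonal matrix, whose entries are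
    nonnegative because conjugation keeps positivity; [B] is the square root of that diagonal times
    the unitary. *)
Lemma psdmx_factor n (A : 'M[C]_n) :
  psdmx A -> exists B : 'M[C]_n, A = B^t* *m B.
Proof.
move=> pA; have nA : A \is normalmx by apply/normalmxP; rewrite psdmx_adj.
have /orthomx_spectralP := nA; set P := spectralmx A; set D := spectral_diag A.
have uP : P \is unitarymx := spectral_unitarymx A.
rewrite invmx_unitary// => AE.
have D0 i : 0 <= D 0 i.
  have : psdmx (diag_mx D).
    have -> : diag_mx D = P *m A *m P^t*.
      by rewrite AE !mulmxA (unitarymxP uP) mul1mx -mulmxA (unitarymxP uP) mulmx1.
    exact: psdmx_conj.
  by move=> /(@psdmx_diag_ge0 _ _ i); rewrite mxE eqxx.
pose S := diag_mx (map_mx sqrtC D).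
exists (S *m P); rewrite adjmxM {1}AE !mulmxA; congr (_ *m _).
rewrite -!mulmxA; congr (_ *m _); rewrite /S.
have -> : (diag_mx (map_mx sqrtC D))^t* = diag_mx (map_mx sqrtC D).
  rewrite tr_diag_mx map_diag_mx; congr diag_mx.
  by apply/rowP => i; rewrite !mxE; apply/CrealP/ger0_real; rewrite sqrtC_ge0.
rewrite mulmx_diag; congr diag_mx; apply/rowP => i.
by rewrite !mxE -expr2 sqrtCK.
Qed.

(** Once [A] is factored as [D^t* *m D], cyclicity turns the trace into that of the positive matrix
    [D *m B *m D^t*]. *)
Lemma psdmx_trM_ge0 n (A B : 'M[C]_n) : psdmx A -> psdmx B -> 0 <= \tr (A *m B).
Proof.
move=> /psdmx_factor[D ->] pB; rewrite -mulmxA mxtrace_mulC.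
exact/psdmx_tr_ge0/psdmx_conj.
Qed.

Lemma Re_ge0 (z : C) : 0 <= z -> 0 <= complex.Re z.
Proof. by rewrite lecE => /andP[]. Qed.

Lemma Re_scale (a : R) (z : C) : complex.Re (a%:C * z) = a * complex.Re z.
Proof. by case: z => u v /=; rewrite mul0r subr0. Qed.

Lemma ReD (z w : C) : complex.Re (z + w) = complex.Re z + complex.Re w.
Proof. by case: z w => [? ?] [? ?]. Qed.

Lemma ReB (z w : C) : complex.Re (z - w) = complex.Re z - complex.Re w.
Proof. by case: z w => [? ?] [? ?]. Qed.

(** [F] and [1%:M - F] give nonnegative values that add up to the trace of [rho], which is 1. *)
Lemma effect_itv n (F rho : 'M[C]_n) : effect F -> density rho ->
  0 <= complex.Re (\tr (F *m rho)) <= 1.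
Proof.
move=> [pF pF'] [pr tr1]; rewrite Re_ge0 ?psdmx_trM_ge0//=.
have := Re_ge0 (psdmx_trM_ge0 pF' pr).
by rewrite mulmxBl mul1mx linearB /= tr1 ReB /= subr_ge0.
Qed.

Lemma density_channel n (K : seq 'M[C]_n) rho :
  channel K -> density rho -> density (apply_channel K rho).
Proof.
move=> chK [pr tr1]; split; first by apply: psdmx_sum => A; exact: psdmx_conj.
rewrite /apply_channel raddf_sum /= -tr1 -[in RHS](mul1mx rho) -chK mulmx_suml.
by rewrite raddf_sum; apply: eq_bigr => A _ /=; rewrite mxtrace_mulC mulmxA.
Qed.

(** Passage to the dual map on observables, by cyclicity of the trace. *)
Lemma tr_apply_channel n (K : seq 'M[C]_n) (F rho : 'M[C]_n) :
  \tr (F *m apply_channel K rho) =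
  \tr ((\sum_(A <- K) A^t* *m F *m A) *m rho).
Proof.
rewrite mulmx_sumr mulmx_suml !raddf_sum; apply: eq_bigr => A _ /=.
by rewrite !mulmxA mxtrace_mulC !mulmxA.
Qed.

(** Trace preservation makes the dual map unital, so it carries the complement of [F] to the
    complement of its image. *)
Lemma effect_channel n (K : seq 'M[C]_n) F :
  channel K -> effect F -> effect (\sum_(A <- K) A^t* *m F *m A).
Proof.
move=> chK [pF pF']; split; first by apply: psdmx_sum => A; exact: psdmx_conjV.
rewrite -{1}chK -sumrB; apply: psdmx_sum => A.
by rewrite -{1}[A^t*]mulmx1 -mulmxBl -mulmxBr; exact: psdmx_conjV.
Qed.

Lemma channel_seq1 n (W : 'M[C]_n) : W^t* *m W = 1%:M -> channel [:: W].
Proof. by rewrite /channel big_seq1. Qed.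

Lemma apply_channel_seq1 n (W rho : 'M[C]_n) :
  apply_channel [:: W] rho = W *m rho *m W^t*.
Proof. by rewrite /apply_channel big_seq1. Qed.

End PositiveSemidefinite.

(** * Rotations generated by a hermitian involution *)

Section Rotation.
Variable R : realType.
Local Notation C := R[i].

(** [c] and [s] stand for the cosine and sine of an angle, left free so that rational points of the
    unit circle can be substituted. *)
Definition rotation n (Z : 'M[C]_n) (c s : R) : 'M[C]_n :=
  c%:C%:M - (0 +i* s) *: Z.

Variables (n : nat) (Z : 'M[C]_n).
Hypotheses (adjZ : Z^t* = Z) (ZZ : Z *m Z = 1%:M).

Lemma adj_rotation (c s : R) : (rotation Z c s)^t* = rotation Z c (- s).
Proof.
rewrite /rotation adjmxB adjmxZ adjZ tr_scalar_mx map_scalar_mx /=.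
by congr (_%:M - _ *: _); exact: conjc_real.
Qed.

Lemma rotationN (c s : R) : rotation Z c (- s) = c%:C%:M + (0 +i* s) *: Z.
Proof.
rewrite /rotation -scaleNr; congr (_ + _ *: _).
by apply/eqP; rewrite eq_complex /= oppr0 opprK !eqxx.
Qed.

Lemma sqr_imaginary (s : R) : (0 +i* s) * (0 +i* s) = - (s ^+ 2)%:C :> C.
Proof.
by apply/eqP; rewrite eq_complex /=; apply/andP; split; apply/eqP; ring.
Qed.

Lemma rotation_unitary (c s : R) : c ^+ 2 + s ^+ 2 = 1 ->
  (rotation Z c s)^t* *m rotation Z c s = 1%:M.
Proof.
move=> cs1; rewrite adj_rotation rotationN /rotation mulmxBr !mulmxDl.
rewrite -!scalemxAl -!scalemxAr ZZ !mul_mx_scalar mul_scalar_mx scale_scalar_mx.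
rewrite !scalerA sqr_imaginary opprD addrA addrK scaleNr opprK.
rewrite -scalemx1 -scalerDl -[RHS]scale1r; congr (_ *: _).
by rewrite -[1]/(1%:C) -cs1 -expr2 -rmorphXn -rmorphD.
Qed.

(** Grouping the cross terms of the expansion as [i] times a commutator leaves real coefficients,
    which pass through [complex.Re]. *)
Lemma tr_rotation_conj (c s : R) (F rho : 'M[C]_n) :
  \tr (F *m (rotation Z c s *m rho *m (rotation Z c s)^t*)) =
  (c ^+ 2)%:C * \tr (F *m rho) + (s ^+ 2)%:C * \tr (F *m (Z *m rho *m Z)) +
  (c * s)%:C * ((0 +i* 1) * \tr (F *m (rho *m Z - Z *m rho))).
Proof.
rewrite adj_rotation rotationN /rotation.
rewrite !(mulmxDl, mulmxDr, mulNmx, mulmxN, mul_scalar_mx, mul_mx_scalar).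
rewrite -!(scalemxAl, scalemxAr) !(mulmxDr, mulmxN) -!scalemxAr !mulmxA !scalerA.
rewrite !mxtraceD !mxtraceZ mxtraceD !raddfN /= !mxtraceZ sqr_imaginary.
have -> : (0 +i* s) = s%:C * (0 +i* 1) :> C.
  by apply/eqP; rewrite eq_complex /=; apply/andP; split; apply/eqP; ring.
by rewrite !rmorphXn !rmorphM /=; ring.
Qed.

(* Both sides of [tr_rotation_conj] lie in [0, 1] for every (c, s) on the unit
   circle; the difference of its values at (3/5, 4/5) and (3/5, -4/5) bounds the
   coefficient of [c * s] by 25/24, without any trace norm. *)
Lemma rotation_gap (c s : R) (F rho : 'M[C]_n) :
  c ^+ 2 + s ^+ 2 = 1 -> effect F -> density rho ->
  `|complex.Re (\tr (F *m (rotation Z c s *m rho *m (rotation Z c s)^t*))) -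
    complex.Re (\tr (F *m rho))| <= 3 * `|s|.
Proof.
move=> cs1 eF dr.
have itv U : U^t* *m U = 1%:M ->
    0 <= complex.Re (\tr (F *m (U *m rho *m U^t*))) <= 1.
  move=> /channel_seq1 chU; rewrite -apply_channel_seq1.
  exact/effect_itv/density_channel.
set a := complex.Re (\tr (F *m rho)).
pose b := complex.Re (\tr (F *m (Z *m rho *m Z))).
pose h := complex.Re ((0 +i* 1) * \tr (F *m (rho *m Z - Z *m rho))).
have /andP[a0 a1] : 0 <= a <= 1 := effect_itv eF dr.
(* [Z] is itself unitary, being a hermitian involution. *)
have /andP[b0 b1] : 0 <= b <= 1 by have := itv Z; rewrite adjZ => /(_ ZZ).
have gE u v :
    complex.Re (\tr (F *m (rotation Z u v *m rho *m (rotation Z u v)^t*))) =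
    u ^+ 2 * a + v ^+ 2 * b + u * v * h.
  by rewrite tr_rotation_conj !ReD !Re_scale.
have gI u v : u ^+ 2 + v ^+ 2 = 1 ->
    0 <= u ^+ 2 * a + v ^+ 2 * b + u * v * h <= 1.
  by move=> uv1; rewrite -gE; exact/itv/rotation_unitary.
rewrite gE {gE itv}; clearbody a b h.
have /andP[p0 p1] := gI (3 / 5) (4 / 5) ltac:(by field).
have /andP[q0 q1] := gI (3 / 5) (- (4 / 5)) ltac:(by field).
have s1 : `|s| <= 1.
  by rewrite -sqrtr_sqr -sqrtr1 ler_sqrt// -cs1 lerDr sqr_ge0.
have c1 : `|c| <= 1.
  by rewrite -sqrtr_sqr -sqrtr1 ler_sqrt// -cs1 lerDl sqr_ge0.
(* Eliminating [c ^+ 2] cancels the lone [a], so every remaining term carries a factor [s]. *)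
have -> : c ^+ 2 * a + s ^+ 2 * b + c * s * h - a = s ^+ 2 * (b - a) + c * s * h.
  have -> : c ^+ 2 = 1 - s ^+ 2 by rewrite -cs1 addrK.
  by ring.
have h1 : `|h| <= 2 by rewrite ler_norml; apply/andP; split; lra.
have ba1 : `|b - a| <= 1 by rewrite ler_norml; apply/andP; split; lra.
apply: (le_trans (ler_normD _ _)); rewrite !normrM.
(* The share 1 pays for [s ^+ 2 * (b - a)] and the share 2 for [c * s * h]. *)
have -> : 3 * `|s| = `|s| * (1 * 1) + `|s| * (1 * 2) by ring.
apply: lerD.
  by rewrite -mulrA; apply: ler_wpM2l => //; apply: ler_pM.
by rewrite [`|c| * _]mulrC -mulrA; apply: ler_wpM2l => //; apply: ler_pM.
Qed.

End Rotation.

(** * Single-qubit gates extended to the register and the memory *)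

Section QubitGates.
Variable R : realType.
Local Notation C := R[i].

(** Mean value theorem with derivative [cos] bounded by 1; oddness of [sin] reduces to [0 <= t]. *)
Lemma norm_sin_le (t : R) : `|sin t| <= `|t|.
Proof.
wlog t0 : t / 0 <= t => [hw|].
  have [/hw//|/ltW] := leP 0 t; rewrite -oppr_ge0 => /hw.
  by rewrite sinN !normrN.
have [|u _] := @MVT_segment R (@sin R) (@cos R) 0 t t0.
  apply: continuous_subspaceT; exact: continuous_sin.
rewrite sin0 !subr0 => ->; rewrite normrM ler_piMl//.
by rewrite ler_norml cos_geN1 cos_le1.
Qed.

Lemma on_qubitB k (p : 'I_k) (U V : 'M[C]_2) :
  on_qubit p (U - V) = on_qubit p U - on_qubit p V.
Proof.
by apply/matrixP => a b; rewrite !mxE; case: ifP => _; rewrite ?subr0.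
Qed.

Lemma on_qubitZ k (p : 'I_k) (a : C) (U : 'M[C]_2) :
  on_qubit p (a *: U) = a *: on_qubit p U.
Proof.
by apply/matrixP => i j; rewrite !mxE; case: ifP => _; rewrite ?mulr0.
Qed.

Lemma on_qubit_diag k (p : 'I_k) (u : 'rV[C]_2) :
  on_qubit p (diag_mx u) = diag_mx (\row_a u 0 (qbits a p)).
Proof.
apply/matrixP => a b; rewrite !mxE; have [->|ab] := eqVneq a b.
  by rewrite eqxx; case: forallP => // -[] p'; apply/implyP.
(* Distinct basis states that agree outside [p] differ at [p], where the entry of a diagonal gate
   vanishes. *)
case: forallP => // H; have [Hp|//] := eqVneq; case/eqP: ab.
apply: enum_val_inj; apply/ffunP => p'; have [->//|pp'] := eqVneq p' p.
by apply/eqP; have := H p'; rewrite pp'.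
Qed.

Lemma on_qubit1 k (p : 'I_k) : on_qubit p 1%:M = 1%:M :> 'M[C]_(qdim k).
Proof.
rewrite -!diag_const_mx on_qubit_diag.
by congr diag_mx; apply/rowP => a; rewrite !mxE.
Qed.

Definition qubitZ k m (p : 'I_k) : 'M[C]_(qdim k * m) :=
  mxtens.tensmx (on_qubit p (pauliZ R)) 1%:M.

Lemma adj_qubitZ k m (p : 'I_k) : (qubitZ m p)^t* = qubitZ m p.
Proof.
rewrite /qubitZ mxtens.trmx_tens mxtens.map_mxT trmx1 map_mx1.
congr mxtens.tensmx; rewrite /pauliZ on_qubit_diag tr_diag_mx map_diag_mx.
by congr diag_mx; apply/rowP => a; rewrite !mxE rmorphXn rmorphN1.
Qed.

Lemma tens1mx1 m n : mxtens.tensmx (1%:M : 'M[C]_m) (1%:M : 'M[C]_n) = 1%:M.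
Proof.
apply/matrixP => i j; case: (mxtens.mxtens_indexP i) => i1 i2.
case: (mxtens.mxtens_indexP j) => j1 j2; rewrite mxtens.tensmxE !mxE.
rewrite (inj_eq (can_inj (@mxtens.mxtens_indexK _ _))) -natrM mulnb.
by rewrite xpair_eqE.
Qed.

Lemma qubitZK k m (p : 'I_k) : qubitZ m p *m qubitZ m p = 1%:M.
Proof.
rewrite /qubitZ mxtens.tensmx_mul mulmx1 /pauliZ on_qubit_diag mulmx_diag.
rewrite -[RHS]tens1mx1; congr mxtens.tensmx; rewrite -diag_const_mx.
congr diag_mx; apply/rowP => a.
by rewrite !mxE -expr2 -exprM mulnC exprM sqrrN !expr1n.
Qed.

(** Both embeddings are linear and preserve the identity, so Euler's formula survives them; this
    puts the gate of B within reach of [rotation_gap]. *)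
Lemma tens_expNiZ k m (p : 'I_k) (t : R) :
  mxtens.tensmx (on_qubit p (expNiZ t)) (1%:M : 'M[C]_m) =
  rotation (qubitZ m p) (cos t) (sin t).
Proof.
rewrite /expNiZ on_qubitB on_qubitZ -[_%:C%:M]scalemx1 on_qubitZ on_qubit1.
rewrite /rotation -[X in _ = X - _]scalemx1 -tens1mx1 /qubitZ.
by apply/matrixP => i j; rewrite !mxE mulrBl !mulrA.
Qed.

End QubitGates.

(** * The hybrid argument over the turns *)

Section Hybrid.
Variables (R : realType) (k : nat) (s : strategy R k).
Hypothesis valid_s : valid_strategy s.
Local Notation C := R[i].
Local Notation D := (qdim k * memory s)%N.
Local Notation extend U := (mxtens.tensmx U (1%:M : 'M[C]_(memory s))).
Local Notation prob F rho := (complex.Re (\tr (F *m rho))).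

Definition unitary_gate (U : 'M[C]_(qdim k)) : Prop :=
  (extend U)^t* *m extend U = 1%:M.

(** Uniform in [F] and [rho], since at a given turn both are dictated by the strategy and the other
    turns. *)
Definition gate_gap (U : 'M[C]_(qdim k)) (g : R) : Prop :=
  forall F rho : 'M[C]_D, effect F -> density rho ->
    `|prob F (extend U *m rho *m (extend U)^t*) - prob F rho| <= g.

Lemma density_gate U (rho : 'M[C]_D) : unitary_gate U -> density rho ->
  density (extend U *m rho *m (extend U)^t*).
Proof.
by move=> /channel_seq1 chU; rewrite -apply_channel_seq1; exact: density_channel.
Qed.

Lemma density_run (V : seq 'M[C]_(qdim k)) t (rho : 'M[C]_D) :
  (forall U, U \in V -> unitary_gate U) -> density rho ->
  density (run V t rho).
Proof.
have [_ chs _] := valid_s.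
elim: V t rho => //= U V IH t rho uV dr; apply: IH => [U' U'V|].
  by apply: uV; rewrite inE U'V orbT.
by apply/density_channel/density_gate => //; apply: uV; rewrite inE eqxx.
Qed.

(* Heisenberg picture: all later steps are absorbed into the measurement. *)
Lemma effect_run (V : seq 'M[C]_(qdim k)) t (G : 'M[C]_D) :
  (forall U, U \in V -> unitary_gate U) -> effect G ->
  exists2 F : 'M[C]_D, effect F &
    forall rho, \tr (G *m run V t rho) = \tr (F *m rho).
Proof.
have [_ chs _] := valid_s.
move=> + eG; elim: V t => /= [|U V IH] t uV; first by exists G.
have [U' U'V|F eF FE] := IH t.+1; first by apply: uV; rewrite inE U'V orbT.
have /channel_seq1 chU := uV U (mem_head _ _).
exists (\sum_(A <- [:: extend U])
          A^t* *m (\sum_(B <- step s t) B^t* *m F *m B) *m A).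
  by do 2! apply: effect_channel => //.
by move=> rho; rewrite FE tr_apply_channel -apply_channel_seq1 tr_apply_channel.
Qed.

(** Induction on the turns, through the intermediate run in which B applies the current gate and
    then stays idle. *)
Lemma run_gap (T : eqType) (U : T -> 'M[C]_(qdim k)) (g : T -> R) (l : seq T)
    t (rho : 'M[C]_D) (G : 'M[C]_D) :
  (forall u, unitary_gate (U u)) -> (forall u, gate_gap (U u) (g u)) ->
  effect G -> density rho ->
  `|prob G (run [seq U u | u <- l] t rho) -
    prob G (run [seq 1%:M | u <- l] t rho)| <= \sum_(u <- l) g u.
Proof.
have [_ chs _] := valid_s.
move=> uU gU eG; elim: l t rho => [|u l IH] t rho dr /=.
  by rewrite subrr normr0 big_nil.
rewrite tens1mx1 mul1mx adjmx1 mulmx1 big_cons [leRHS]addrC.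
have h1 := IH t.+1 _ (density_channel (chs t) (density_gate (uU u) dr)).
(* The idle remainder is absorbed into an effect, so that only the current gate is compared with the
   identity. *)
have [|F eF FE] := @effect_run [seq 1%:M | _ <- l] t.+1 G _ eG.
  by move=> _ /mapP[v _ ->]; rewrite /unitary_gate tens1mx1 adjmx1 mulmx1.
have h2 := gU u _ _ (effect_channel (chs t) eF) dr.
rewrite -!tr_apply_channel -!FE in h2.
exact: le_trans (ler_distD _ _ _) (lerD h1 h2).
Qed.

Lemma success_gap (T : eqType) (U : bool -> T -> 'M[C]_(qdim k)) (g : T -> R)
    (l : seq T) :
  (forall u, U false u = 1%:M) ->
  (forall u, unitary_gate (U true u)) ->
  (forall u, gate_gap (U true u) (g u)) ->
  `|success s (fun b => [seq U b u | u <- l]) - 1 / 2| <=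
    2^-1 * \sum_(u <- l) g u.
Proof.
move=> U0 uU gU; have [ds chs eG] := valid_s.
have U0E : [seq U false u | u <- l] = [seq 1%:M | _ <- l] by exact: eq_map.
have [|_ tr1] := @density_run [seq 1%:M | _ <- l] 0 _ _ ds.
  move=> _ /mapP[v _ ->]; rewrite /unitary_gate tens1mx1 adjmx1 mulmx1 //.
rewrite /success U0E mulmxBl mul1mx raddfB /= tr1 ReB /=.
have := run_gap l 0 uU gU eG ds.
set a := complex.Re _; set b := complex.Re _ => ab.
(* As the idle run ends with trace 1, success exceeds 1/2 by half the change in the probability of
   the guess. *)
have -> : 2^-1 * a + 2^-1 * (1 - b) - 1 / 2 = 2^-1 * (a - b) by field.
by rewrite normrM gtr0_norm ?invr_gt0// ler_wpM2l// invr_ge0.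
Qed.

End Hybrid.

(** * The supremum over strategies *)

Lemma valid_strategy_ex (R : realType) (k : nat) :
  exists s : strategy R k, valid_strategy s.
Proof.
have Q0 : (0 < qdim k * 1)%N.
  by rewrite muln1 /qdim card_ffun !card_ord expn_gt0.
pose i0 := Ordinal Q0.
(* Trivial memory, a pure basis state, identity steps, and a guess that never claims
   participation. *)
exists (@Strategy R k 1 (delta_mx i0 i0) (fun=> [:: 1%:M]) 0); split => /=.
- split; last first.
    rewrite /mxtrace (bigD1 i0)//= big1 => [|j ji].
      by rewrite mxE eqxx addr0.
    by rewrite mxE (negPf ji).
  have -> : delta_mx i0 i0 = (delta_mx 0 i0 : 'rV[R[i]]_(qdim k * 1))^t*
                              *m 1%:M *m delta_mx 0 i0.
    by rewrite mulmx1 trmx_delta map_delta_mx mul_delta_mx.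
  exact/psdmx_conjV/psdmx1.
- by move=> t; apply: channel_seq1; rewrite adjmx1 mulmx1.
- by split; [exact: psdmx0 | rewrite subr0; exact: psdmx1].
Qed.

(** The set of success probabilities is nonempty by [valid_strategy_ex] and bounded by hypothesis,
    so [sup] is a genuine supremum; a single member gives the lower bound. *)
Lemma max_success_gap (R : realType) (k : nat) (V : bool -> seq 'M[R[i]]_(qdim k))
    (g : R) :
  (forall s : strategy R k, valid_strategy s -> `|success s V - 1 / 2| <= g) ->
  `|max_success V - 1 / 2| <= g.
Proof.
move=> sg; have [s0 v0] := valid_strategy_ex R k.
rewrite /max_success; set E := (X in sup X).
have E0 : E (success s0 V) by exists s0.
have Eg w : E w -> w <= 1 / 2 + g.
  by move=> [s /sg + ->]; rewrite ler_norml => /andP[_]; rewrite lerBlDl.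
rewrite ler_norml; apply/andP; split.
  rewrite lerBrDl; apply: (@le_trans _ _ (success s0 V)).
    by have := sg _ v0; rewrite ler_norml => /andP[+ _]; rewrite lerBrDl.
  by apply: ub_le_sup => //; exists (1 / 2 + g).
by rewrite lerBlDl; apply: ge_sup => //; exists (success s0 V).
Qed.

(** * Total effect of the phases imprinted in one round *)

Section Responses.
Variable R : realType.

(** The bound of [rotation_gap] with the sine replaced by its angle; a turn without the cluster of B
    costs nothing. *)
Definition response_gap (N d k : nat) (x : 'rV[R]_d) (p : 'I_k)
    (t : turn d k) : R :=
  let phase := (if t.1 is Some q then x 0 q else 1) / N%:R in
  if p \in t.2 then 3 * `|phase / 2| else 0.

Lemma response_unitary (k : nat) (s : strategy R k) b N d (x : 'rV[R]_d)
    (p : 'I_k) t : unitary_gate s (response b N x p t).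
Proof.
rewrite /response /unitary_gate; case: ifP => _; last first.
  by rewrite tens1mx1 adjmx1 mulmx1.
rewrite tens_expNiZ rotation_unitary ?cos2Dsin2//; first exact: adj_qubitZ.
exact: qubitZK.
Qed.

Lemma response_gapP (k : nat) (s : strategy R k) N d (x : 'rV[R]_d)
    (p : 'I_k) t : gate_gap s (response true N x p t) (response_gap N x p t).
Proof.
rewrite /response /response_gap => F rho eF dr /=; case: ifP => _; last first.
  by rewrite tens1mx1 adjmx1 mulmx1 mul1mx subrr normr0.
rewrite tens_expNiZ.
have := rotation_gap (adj_qubitZ R (memory s) p) (qubitZK R _ p) (cos2Dsin2 _) eF dr.
set h := _ / N%:R; move=> /(_ (h / 2)) /le_trans; apply.
by rewrite ler_wpM2l// norm_sin_le.
Qed.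

(** Flattens rounds and turns into one index list independent of [b], the form required by
    [success_gap]. *)
Lemma responsesE b rounds N d k (x : 'rV[R]_d) (f : 'I_rounds -> 'I_k) n4 n5 :
  responses b N x f n4 n5 =
  [seq response b N x (f u.1) u.2 |
     u <- [seq (r, t) | r <- enum 'I_rounds, t <- round_turns (n4 r) (n5 r)]].
Proof. by rewrite map_allpairs. Qed.

Lemma sum_iota_ltn (n m : nat) (a : R) : (n <= m)%N ->
  \sum_(t <- iota 0 m) (if (t < n)%N then a else 0) = n%:R * a.
Proof.
move=> nm; rewrite -[m in iota 0 m](subn0 m) -big_mkcond /=.
rewrite (eq_bigl (fun t => true && (t < n)%N))// -big_nat_widen//.
by rewrite big_const_nat subn0 iter_addr_0 mulr_natl.
Qed.

Lemma round_gap (N d k : nat) (x : 'rV[R]_d) (X : R) (p : 'I_k) n4 n5 :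
  (forall q, `|x 0 q| <= X) ->
  \sum_(t <- round_turns n4 n5) response_gap N x p t <=
  3 / 2 / N%:R * (n4%:R + X * (\sum_(q < d) n5 p q)%:R).
Proof.
move=> xX; rewrite /round_turns big_cat /= big_flatten big_map /=.
rewrite mulrDr lerD//.
  rewrite big_nseq iter_addr_0 /response_gap /= inE -[leLHS]mulr_natl.
  rewrite ger0_norm; last by rewrite !mulr_ge0// ?invr_ge0.
  by rewrite (_ : n4%:R * _ = 3 / 2 / N%:R * n4%:R)//; ring.
rewrite natr_sum !mulr_sumr big_enum /= ler_sum// => q _.
rewrite big_map /response_gap /=.
under eq_bigr do rewrite inE.
(* The turns for [q] run up to the maximum over all clusters, but cluster [p] is active only in the
   first [n5 p q]. *)
rewrite sum_iota_ltn; last exact: leq_bigmax.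
rewrite !normrM !normfV !normr_nat.
have -> : (n5 p q)%:R * (3 * (`|x 0 q| / N%:R / 2)) =
          3 / 2 / N%:R * (`|x 0 q| * (n5 p q)%:R) by ring.
by rewrite ler_wpM2l ?mulr_ge0 ?invr_ge0// ler_wpM2r.
Qed.

End Responses.

(** * Bounds on the minimal fraction and the final estimate *)

Lemma min_fraction_le (R : realType) rounds N k (S : 'I_rounds -> {set 'I_N})
    (f : 'I_rounds -> 'I_N -> 'I_k) r p :
  min_fraction R S f <= fraction R (S r) (f r) p.
Proof.
by apply: (le_trans (bigmin_le_cond _ _ (isT : xpredT r)));
   exact: (bigmin_le_cond _ _ (isT : xpredT p)).
Qed.

Lemma min_fraction_le1 (R : realType) rounds N k (S : 'I_rounds -> {set 'I_N})
    (f : 'I_rounds -> 'I_N -> 'I_k) :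
  min_fraction R S f <= 1.
Proof. exact: bigmin_le_id. Qed.

Theorem theorem12 (R : realType) (c X : R) :
  exists K : R,
  forall (N d k rounds : nat) (B : 'I_N) (eps : R)
    (x : 'I_N -> 'rV[R]_d)
    (mu : 'I_rounds -> 'I_k -> 'rV[R]_d)
    (f : 'I_rounds -> 'I_N -> 'I_k)
    (S : 'I_rounds -> {set 'I_N})
    (n4 : 'I_rounds -> nat) (n5 : 'I_rounds -> 'I_k -> 'I_d -> nat),
  (0 < d)%N -> (0 < k)%N -> (0 < rounds)%N -> 0 < eps ->
  (forall q : 'I_d, `|x B 0 q| <= X) ->
  (forall (r : 'I_rounds) (i : 'I_N), closest (x i) (mu r) (f r i)) ->
  (forall r : 'I_rounds, (n4 r)%:R <= c / eps) ->
  (forall (r : 'I_rounds) (p : 'I_k),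
     (\sum_(q < d) n5 r p q)%:R <= c * (d%:R / (eps * fraction R (S r) (f r) p))) ->
  eps < min_fraction R S f ->
  `| max_success (fun b => responses b N (x B) (fun r => f r B) n4 n5) - 1 / 2 |
    <= K * (rounds%:R * d%:R / (min_fraction R S f * N%:R * eps)).
Proof.
(* The factor 3/4 is 3/2 from the halved phases times 1/2 from the prior; [1] accounts for the
   fraction turns and [|X|] for the component turns. Absolute values cover every sign of [c] and
   [X]. *)
exists (3 / 4 * `|c| * (1 + `|X|)) => N d k rounds B eps x mu f S n4 n5.
move=> d0 _ _ eps0 xX _ n4c n5c epsm; apply: max_success_gap => s vs.
rewrite (_ : (fun b => _) = fun b =>
  [seq response b N (x B) (f u.1 B) u.2 |
     u <- [seq (r, t) | r <- enum 'I_rounds, t <- round_turns (n4 r) (n5 r)]]);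
  last by apply/funext => b; rewrite responsesE.
apply: (le_trans (success_gap (g := fun u => response_gap N (x B) (f u.1 B) u.2)
  vs _ _ _ _)) => [u|u|u|]; [by []|exact: response_unitary|exact: response_gapP|].
rewrite big_allpairs_dep /= big_enum /=.
set m := min_fraction R S f in epsm *.
have m0 : 0 < m := lt_trans eps0 epsm.
have N0 : 0 < N%:R :> R by rewrite ltr0n (leq_trans _ (ltn_ord B)).
have d1 : 1 <= d%:R :> R by rewrite ler1n.
(* A common bound on both turn counts, obtained by lowering each fraction to the minimum [m]. *)
pose T := `|c| * (d%:R / (m * eps)).
have round_le r : \sum_(t <- round_turns (n4 r) (n5 r))
    response_gap N (x B) (f r B) t <= 3 / 2 / N%:R * (T + `|X| * T).
  have xX' q : `|x B 0 q| <= `|X| := le_trans (xX q) (ler_norm _).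
  apply: (le_trans (round_gap N (f r B) (n4 r) (n5 r) xX')).
  have p_m := min_fraction_le R S f r (f r B).
  have p0 := lt_le_trans m0 p_m.
  rewrite ler_wpM2l ?mulr_ge0 ?invr_ge0 ?ler0n// lerD ?ler_wpM2l//.
    apply: (le_trans (n4c r)).
    apply: (@le_trans _ _ (`|c| / eps)).
      by rewrite ler_wpM2r ?ler_norm// invr_ge0 ltW.
    (* The comparison reduces to [m <= d], which holds because [m <= 1 <= d]. *)
    rewrite /T ler_wpM2l// ler_pdivlMr ?mulr_gt0// mulrCA mulVf ?gt_eqF//.
    by rewrite mulr1 (le_trans (min_fraction_le1 _ _ _)).
  apply: (le_trans (n5c r (f r B))).
  apply: (@le_trans _ _ (`|c| * (d%:R / (eps * fraction R (S r) (f r) (f r B))))).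
    by rewrite ler_wpM2r ?ler_norm// divr_ge0 ?ler0n// mulr_ge0// ltW.
  rewrite /T ler_wpM2l// ler_wpM2l ?ler0n// [m * eps]mulrC.
  by rewrite lef_pV2 ?ler_pM2l// posrE; exact: mulr_gt0.
have : \sum_(r < rounds) \sum_(t <- round_turns (n4 r) (n5 r))
    response_gap N (x B) (f r B) t <=
    \sum_(r < rounds) 3 / 2 / N%:R * (T + `|X| * T).
  by apply: ler_sum => i _; exact: round_le.
rewrite sumr_const card_ord -mulr_natl => /(ler_wpM2l (_ : 0 <= 2^-1)).
move=> /(_ _) /le_trans; apply; first by rewrite invr_ge0.
(* The accumulated bound equals the claimed one exactly, by the choice of [K]. *)
rewrite le_eqVlt; apply/orP; left; apply/eqP; rewrite /T; field.
by rewrite !gt_eqF.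
Qed.
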